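(* Let $X$ be a finite non-empty set, let $\sigma,\tau$ be commuting permutations of $X$, and let $(X,r)$ be the Lyubashenko solution $r(x,y)=(\sigma(y),\tau(x))$, $x,y\in X$. Then the structure monoid $M=M(X,r)$ is Malcev nilpotent if and only if $\sigma=c_1^{k_1}\dotsm c_s^{k_s}$ and $\tau=c_1^{1-k_1}\dotsm c_s^{1-k_s}$ for some disjoint cycles $c_1,\dotsc,c_s$ on $X$ (cycles of length one being allowed, so that the contents of $c_1,\dotsc,c_s$ partition $X$) and some integers $k_1,\dotsc,k_s$. In this case, all cancellative components of $M$ are abelian, the group of fractions of each of them is of rank $j$ for some $1\leq j\leq s$, and every such number $j$ is attained. Furthermore, in this case all uniform components of $M$ have degree $1$.
   Context: A solution of the YBE is a pair $(X,r)$ with $r\colon X^2\to X^2$, $r(x,y)=(\lambda_x(y),\rho_y(x))$, bijective, all $\lambda_x,\rho_y$ bijective, and $(r\times\mathrm{id})(\mathrm{id}\times r)(r\times\mathrm{id})=(\mathrm{id}\times r)(r\times\mathrm{id})(\mathrm{id}\times r)$ on $X^3$. A Lyubashenko solution is a finite one with $\lambda_x=\sigma$, $\rho_y=\tau$ for all $x,y$. Malcev nilpotency: for a semigroup $S$, $s,t\in S$ and $u_1,u_2,\dotsc\in S^1$ ($S^1$ is the smallest monoid containing $S$) put $x_0=s$, $y_0=t$, $x_{k+1}=x_ku_{k+1}y_k$, $y_{k+1}=y_ku_{k+1}x_k$. $S$ is Malcev nilpotent if there is $k\ge 0$ such that $x_k=y_k$ for all $s,t\in S$ and all $u_1,\dotsc,u_k\in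 S^1$. Structure monoids: write $X=\{x_1,\dotsc,x_n\}$. $M=M(X,r)$ is the monoid generated by $X$ with relations $x\circ y=\lambda_x(y)\circ\rho_y(x)$. $A=A(X,r)$ is the monoid (written additively, identity $0$) generated by $X$ with relations $x+\lambda_x(y)=\lambda_x(y)+\lambda_{\lambda_x(y)}(\rho_y(x))$; the generator of $A$ corresponding to $x_i$ is denoted $a_i$. There is a homomorphism $\lambda'\colon M\to\mathrm{Aut}(A,+)$ such that $\lambda'_x$ acts on the generators of $A$ as $\lambda_x$ for $x\in X$, and a unique bijective $1$-cocycle $\pi\colon M\to A$ with $\pi(x_i)=a_i$ and $\pi(m_1\circ m_2)=\pi(m_1)+\lambda'_{m_1}(\pi(m_2))$. For $a\in A$ write $\lambda'_a=\lambda'_{\pi^{-1}(a)}$. Identify $M$ with $\{(a,\lambda'_a):a\in A\}\subseteq A\rtimes\mathrm{Im}(\lambda')$ via $m\mapsto(\pi(m),\lambda'_m)$, with product $(a,\lambda'_a)(b,\lambda'_b)=(a+\lambda'_a(b),\lambda'_a\lambda'_b)$. Every $a\in A$ satisfies $a+A=A+a$; $b\mid a$ means $a\in b+A$. $A_i$ is the set of $a\in A$ divisible by at least $i$ different generators amongst $a_1,\dotsc,a_n$. There is an integer $d\geq 2$ such that $da$ is central in $A$ and $\lambda'_{da}=\mathrm{id}$ for all $a\in A$. For $Y\subseteq\{a_1,\dotsc,a_n\}$ non-empty put $a_Y=\sum_{y\in Y}dy$ and $m_Y=(a_Y,\mathrm{id})\in M$. For $Y,Z\subseteq\{a_1,\dotsc,a_n\}$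 with $|Y|=|Z|=i$ put $M_{YZ}=\{(a,\lambda'_a):a\in A\setminus A_{i+1},\ y\mid a\text{ for all }y\in Y,\ \lambda'_a(Z)=Y\}$. The integer $d$ is fixed and chosen (replacing it by a multiple if necessary) such that $m_YM_{YY}$ is cancellative whenever $a_Y\notin A_{|Y|+1}$. Cancellative components of $M$: the semigroups $m_YM_{YY}$ with $Y$ non-empty and $a_Y\notin A_{|Y|+1}$. Uniform components: for $1\le i\le n$ let $\mathcal L_u$ be the set of $Y\subseteq\{a_1,\dotsc,a_n\}$ with $|Y|=i$ and $a_Y\notin A_{i+1}$; on $\mathcal L_u$ the relation $Y\sim Z\iff M_{YZ}\neq\varnothing$ or $M_{ZY}\neq\varnothing$ is an equivalence relation. For each equivalence class $\mathcal L_j$ the corresponding uniform component is $\left(\bigcup_{Y,Z\in\mathcal L_j}m_YM_{YZ}\cup M_{i+1}\right)/M_{i+1}$, where $M_{i+1}=\{(a,\lambda'_a):a\in A_{i+1}\}$, and its degree is $|\mathcal L_j|$. *)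

(* Defs.v *)
From HB Require Import structures.
From mathcomp Require Import all_boot all_order all_algebra all_fingroup.
From mathcomp Require Import generic_quotient boolp classical_sets.

Set Implicit Arguments.
Unset Strict Implicit.
Unset Printing Implicit Defensive.

Local Open Scope group_scope.
Local Open Scope quotient_scope.
Local Open Scope classical_set_scope.

Section PresentedMonoid.
Variables (X : choiceType) (R : seq X -> seq X -> Prop).

Inductive pcongr : seq X -> seq X -> Prop :=
| pcongr_rel u v : R u v -> pcongr u v
| pcongr_refl u : pcongr u u
| pcongr_sym u v : pcongr u v -> pcongr v u
| pcongr_trans u v w : pcongr u v -> pcongr v w -> pcongr u w
| pcongr_cat u1 v1 u2 v2 :
    pcongr u1 v1 -> pcongr u2 v2 -> pcongr (u1 ++ u2) (v1 ++ v2).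

Definition pcongrb u v : bool := `[< pcongr u v >].

Lemma pcongrb_equiv : equiv_class_of pcongrb.
Proof.
split=> [u|u v|v u w].
- exact/asboolP/pcongr_refl.
- by apply/asboolP/asboolP; apply: pcongr_sym.
- by move=> /asboolP uv /asboolP vw; apply/asboolP/(pcongr_trans uv vw).
Qed.

Definition pcongr_equiv := EquivRelPack pcongrb_equiv.

(* The monoid < X | R >: words over X modulo the congruence generated by R. *)
Definition pmonoid := {eq_quot pcongr_equiv}.
HB.instance Definition _ := Choice.on pmonoid.
HB.instance Definition _ := EqQuotient.on pmonoid.

Definition pword (w : seq X) : pmonoid := \pi_pmonoid w.

Lemma pwordP u v : pword u = pword v <-> pcongr u v.
Proof. by split=> [/eqmodP/asboolP|uv] //; apply/eqmodP/asboolP. Qed.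

Lemma reprP w : pcongr (repr (pword w)) w.
Proof. by apply/pwordP; rewrite /pword reprK. Qed.

Definition pmul (a b : pmonoid) := pword (repr a ++ repr b).

Lemma pword_cat u v : pword (u ++ v) = pmul (pword u) (pword v).
Proof. by apply/esym/pwordP/pcongr_cat; apply: reprP. Qed.

Lemma pwordK a : pword (repr a) = a.
Proof. by rewrite /pword reprK. Qed.

Lemma pmulA : associative pmul.
Proof.
move=> a b c; rewrite -[a]pwordK -[b]pwordK -[c]pwordK.
by rewrite -!pword_cat catA.
Qed.

Lemma pmul1m : left_id (pword [::]) pmul.
Proof. by move=> a; rewrite -[a]pwordK -pword_cat. Qed.

Lemma pmulm1 : right_id (pword [::]) pmul.
Proof. by move=> a; rewrite -[a]pwordK -pword_cat cats0. Qed.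

HB.instance Definition _ := isMonoid.Build pmonoid pmulA pmul1m pmulm1.

End PresentedMonoid.

Section Solutions.
Variable X : finType.

Definition braid_left (r : X * X -> X * X) (t : X * X * X) : X * X * X :=
  (r t.1, t.2).
Definition braid_right (r : X * X -> X * X) (t : X * X * X) : X * X * X :=
  let q := r (t.1.2, t.2) in (t.1.1, q.1, q.2).

Definition solution_map (lam rho : X -> {perm X}) (p : X * X) : X * X :=
  (lam p.1 p.2, rho p.2 p.1).

Record solution := Solution {
  lam : X -> {perm X};
  rho : X -> {perm X};
  solution_bij : bijective (solution_map lam rho);
  solution_ybe : forall t : X * X * X,
    let r := solution_map lam rho in
    braid_left r (braid_right r (braid_left r t)) =
    braid_right r (braid_left r (braid_right r t)) }.

Section Lyubashenko.
Variables (sigma tau : {perm X}) (st : commute sigma tau).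

Lemma lyubashenko_bij :
  bijective (solution_map (fun=> sigma) (fun=> tau)).
Proof.
exists (fun p => (tau^-1 p.2, sigma^-1 p.1)) => -[x y];
by rewrite /solution_map /= ?permK ?permKV.
Qed.

Lemma lyubashenko_ybe (t : X * X * X) :
  let r := solution_map (fun=> sigma) (fun=> tau) in
  braid_left r (braid_right r (braid_left r t)) =
  braid_right r (braid_left r (braid_right r t)).
Proof.
case: t => [[x y] z]; rewrite /braid_left /braid_right /solution_map /=.
by congr (_, _, _); rewrite -!permM st.
Qed.

Definition lyubashenko : solution := Solution lyubashenko_bij lyubashenko_ybe.
End Lyubashenko.

End Solutions.

Section StructureMonoids.
Variables (X : finType) (r : solution X).

Inductive Mrel : seq X -> seq X -> Prop :=
  MRel x y : Mrel [:: x; y] [:: lam r x y; rho r y x].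

Inductive Arel : seq X -> seq X -> Prop :=
  ARel x y : Arel [:: x; lam r x y]
                  [:: lam r x y; lam r (lam r x y) (rho r y x)].

Definition structM : monoidType := pmonoid Mrel.

(* A(X, r) is not commutative in general, hence it is written multiplicatively:
   a * b, 1, a ^+ d stand for a + b, 0, d a. *)
Definition structA : monoidType := pmonoid Arel.

Definition genM (x : X) : structM := pword Mrel [:: x].
Definition genA (x : X) : structA := pword Arel [:: x].

(* lam_{x_1} o ... o lam_{x_k} for the word w = x_1 ... x_k. *)
Definition actw (w : seq X) (y : X) : X := foldr (fun x => lam r x) y w.

(* The functions on words inducing pi and its inverse: x_1 ... x_k is sent by
   cocw to the word with letters (lam_{x_1} o ... o lam_{x_(i-1)}) (x_i). *)
Fixpoint cocw (w : seq X) : seq X :=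
  if w is x :: w' then x :: [seq lam r x y | y <- cocw w'] else [::].

Fixpoint cocVw (g : {perm X}) (w : seq X) : seq X :=
  if w is z :: w' then g z :: cocVw (g * (lam r (g z))^-1) w' else [::].

Definition lamA (m : structM) (a : structA) : structA :=
  pword Arel (map (actw (repr m)) (repr a)).
Definition cocycle (m : structM) : structA := pword Arel (cocw (repr m)).
Definition cocycleV (a : structA) : structM := pword Mrel (cocVw 1 (repr a)).

Lemma actw_cat u v y : actw (u ++ v) y = actw u (actw v y).
Proof. by rewrite /actw foldr_cat. Qed.

Lemma actw_inj w : injective (actw w).
Proof. by elim: w => [|x w IH] y z //= /perm_inj/IH. Qed.

Lemma lam_lam x y z : lam r x (lam r y z) = lam r (lam r x y) (lam r (rho r y x) z).
Proof. by have [] := solution_ybe r (x, y, z). Qed.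

Lemma rho_lam x y z :
  rho r (lam r (rho r y x) z) (lam r x y) = lam r (rho r (lam r y z) x) (rho r z y).
Proof. by have [] := solution_ybe r (x, y, z). Qed.

Lemma actw_congr u v : pcongr Mrel u v -> actw u =1 actw v.
Proof.
elim=> {u v} [_ _ [x y] z|//|u v _ IH z|u v w _ IH1 _ IH2 z|u1 v1 u2 v2 _ IH1 _ IH2 z].
- exact: lam_lam.
- by rewrite IH.
- by rewrite IH1.
- by rewrite !actw_cat IH1 IH2.
Qed.

Lemma map_lam_congr x u v :
  pcongr Arel u v -> pcongr Arel (map (lam r x) u) (map (lam r x) v).
Proof.
elim=> {u v} [_ _ [y z]|u|u v _|u v w _ IH1 _|u1 v1 u2 v2 _ IH1 _ IH2] /=.
- rewrite (lam_lam x (lam r y z)) -rho_lam !(lam_lam x y z).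
  exact/pcongr_rel/ARel.
- exact: pcongr_refl.
- exact: pcongr_sym.
- exact: pcongr_trans.
- by rewrite !map_cat; apply: pcongr_cat.
Qed.

Lemma map_actw_congr w u v :
  pcongr Arel u v -> pcongr Arel (map (actw w) u) (map (actw w) v).
Proof.
move=> uv; elim: w => [|x w IH]; first by rewrite !map_id.
by have := map_lam_congr x IH; rewrite -!map_comp.
Qed.

Lemma lamA_word w u :
  lamA (pword Mrel w) (pword Arel u) = pword Arel (map (actw w) u).
Proof.
rewrite /lamA (eq_map (actw_congr (reprP Mrel w))).
exact/pwordP/map_actw_congr/reprP.
Qed.

Lemma cocw_cat u v : cocw (u ++ v) = cocw u ++ map (actw u) (cocw v).
Proof.
elim: u => [|x u IH] /=; first by rewrite map_id.
by rewrite IH map_cat -map_comp.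
Qed.

Lemma cocw_congr u v : pcongr Mrel u v -> pcongr Arel (cocw u) (cocw v).
Proof.
elim=> {u v} [_ _ [y z]|u|u v _|u v w _ IH1 _|u1 v1 u2 v2 uv1 IH1 _ IH2] /=.
- exact/pcongr_rel/ARel.
- exact: pcongr_refl.
- exact: pcongr_sym.
- exact: pcongr_trans.
- rewrite !cocw_cat (eq_map (actw_congr uv1)).
  by apply: pcongr_cat => //; apply: map_actw_congr.
Qed.

Lemma cocycle_word w : cocycle (pword Mrel w) = pword Arel (cocw w).
Proof. exact/pwordP/cocw_congr/reprP. Qed.

Fixpoint cocVw_end (g : {perm X}) (w : seq X) : {perm X} :=
  if w is z :: w' then cocVw_end (g * (lam r (g z))^-1) w' else g.

Lemma cocVw_cat g u v : cocVw g (u ++ v) = cocVw g u ++ cocVw (cocVw_end g u) v.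
Proof. by elim: u g => [//|z u IH] g /=; rewrite IH. Qed.

Definition inverts (g : {perm X}) (w : seq X) := forall x, g (actw w x) = x.

Lemma invertsV g w x : inverts g w -> actw w (g x) = x.
Proof. by move=> gw; apply: (@perm_inj _ g); rewrite gw. Qed.

Lemma inverts_uniq g1 g2 w1 w2 :
  inverts g1 w1 -> inverts g2 w2 -> actw w1 =1 actw w2 -> g1 = g2.
Proof.
move=> h1 h2 e; apply/permP => x.
by rewrite -[in LHS](invertsV x h2) -e h1.
Qed.

Lemma inverts_step g w z :
  inverts g w -> inverts (g * (lam r (g z))^-1) (w ++ [:: g z]).
Proof. by move=> gw x; rewrite permM actw_cat gw /= permK. Qed.

Lemma cocVw_endP g w u : inverts g w -> inverts (cocVw_end g u) (w ++ cocVw g u).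
Proof.
elim: u g w => [|z u IH] g w gw /=; first by rewrite cats0.
by rewrite -cat_rcons -cats1; apply: IH; apply: inverts_step.
Qed.

Lemma Arel_actw w x y : exists2 y',
  actw w (lam r x y) = lam r (actw w x) y' &
  actw w (lam r (lam r x y) (rho r y x)) =
    lam r (lam r (actw w x) y') (rho r y' (actw w x)).
Proof.
elim: w => [|z w [y' e1 e2]]; first by exists y.
exists (lam r (rho r (actw w x) z) y') => /=.
- by rewrite e1 lam_lam.
- by rewrite e2 rho_lam -!lam_lam.
Qed.

Lemma cocVw_congr u v : pcongr Arel u v ->
  forall g w, inverts g w -> pcongr Mrel (cocVw g u) (cocVw g v).
Proof.
elim=> {u v} [_ _ [a b]|u|u v _ IH|u v w _ IH1 _ IH2|u1 v1 u2 v2 _ IH1 _ IH2] g s gs.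
- rewrite /= !permM.
  set x := g a; set y := (lam r x)^-1 (g (lam r a b)).
  have ex : a = actw s x by rewrite (invertsV _ gs).
  have ey : g (lam r a b) = lam r x y by rewrite permKV.
  have [y' e1 e2] := Arel_actw s x y.
  have eb : y' = b.
    by apply: (@perm_inj _ (lam r a)); rewrite {1}ex -e1 -ey (invertsV _ gs).
  rewrite eb -ex in e2.
  rewrite -e2 gs ey permK; exact/pcongr_rel/MRel.
- exact: pcongr_refl.
- exact: pcongr_sym (IH _ _ gs).
- exact: pcongr_trans (IH1 _ _ gs) (IH2 _ _ gs).
- rewrite !cocVw_cat; have c1 := IH1 _ _ gs.
  have -> : cocVw_end g v1 = cocVw_end g u1.
    apply: inverts_uniq (cocVw_endP v1 gs) (cocVw_endP u1 gs) _ => x.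
    by rewrite !actw_cat (actw_congr c1).
  exact: pcongr_cat c1 (IH2 _ _ (cocVw_endP u1 gs)).
Qed.

Lemma inverts1 : inverts 1 [::].
Proof. by move=> x; rewrite perm1. Qed.

Lemma cocycleV_word w : cocycleV (pword Arel w) = pword Mrel (cocVw 1 w).
Proof. exact/pwordP/(cocVw_congr (reprP _ _) inverts1). Qed.

Lemma cocVwK g w u : inverts g w -> map (actw w) (cocw (cocVw g u)) = u.
Proof.
elim: u g w => [//|z u IH] g w gw /=.
rewrite (invertsV _ gw) -[in RHS](IH _ _ (inverts_step z gw)) -map_comp.
by congr cons; apply: eq_map => x /=; rewrite actw_cat.
Qed.

Lemma cocwK g w u : inverts g w -> cocVw g (map (actw w) (cocw u)) = u.
Proof.
elim: u g w => [//|x u IH] g w gw /=; rewrite gw -map_comp; congr cons.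
rewrite -[in RHS](IH (g * (lam r x)^-1) (w ++ [:: x])).
  by congr cocVw; apply: eq_map => y /=; rewrite actw_cat.
by move=> y; rewrite permM actw_cat gw /= permK.
Qed.

Lemma cocycleK : cancel cocycle cocycleV.
Proof.
move=> m; rewrite -[m]pwordK cocycle_word cocycleV_word.
by rewrite -{1}[cocw _]map_id (cocwK _ inverts1).
Qed.

Lemma cocycleVK : cancel cocycleV cocycle.
Proof.
move=> a; rewrite -[a]pwordK cocycleV_word cocycle_word.
by rewrite -[cocw _]map_id (cocVwK _ inverts1).
Qed.

Lemma cocycle_gen x : cocycle (genM x) = genA x.
Proof. exact: cocycle_word. Qed.

Lemma cocycleM m1 m2 :
  cocycle (m1 * m2 : structM) = (cocycle m1 * lamA m1 (cocycle m2) : structA).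
Proof.
rewrite -[m1]pwordK -[m2]pwordK.
have -> : (pword Mrel (repr m1) * pword Mrel (repr m2) : structM) =
          pword Mrel (repr m1 ++ repr m2) by rewrite pword_cat.
by rewrite !cocycle_word lamA_word cocw_cat pword_cat.
Qed.

Lemma lamA_gen x y : lamA (genM x) (genA y) = genA (lam r x y).
Proof. exact: lamA_word. Qed.

Lemma lamA_mul m a b : lamA m (a * b : structA) = (lamA m a * lamA m b : structA).
Proof.
rewrite -[m]pwordK -[a]pwordK -[b]pwordK.
have e u v : (pword Arel u * pword Arel v : structA) = pword Arel (u ++ v).
  by rewrite pword_cat.
by rewrite e !lamA_word map_cat e.
Qed.

Lemma lamA_act m1 m2 a : lamA (m1 * m2 : structM) a = lamA m1 (lamA m2 a).
Proof.
rewrite -[m1]pwordK -[m2]pwordK -[a]pwordK.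
have -> : (pword Mrel (repr m1) * pword Mrel (repr m2) : structM) =
          pword Mrel (repr m1 ++ repr m2) by rewrite pword_cat.
rewrite !lamA_word -map_comp; congr pword.
by apply: eq_map => x /=; rewrite actw_cat.
Qed.

Lemma lamA1 m : lamA m (1 : structA) = 1.
Proof. by rewrite -[m]pwordK; apply: lamA_word. Qed.

Lemma lamA_id a : lamA (1 : structM) a = a.
Proof. by rewrite -[a]pwordK lamA_word map_id. Qed.


Definition dvdA (b a : structA) : Prop := exists c : structA, a = b * c.

Definition layerA (i : nat) : set structA :=
  [set a | exists2 Y : {set X}, (i <= #|Y|)%N &
           forall y, y \in Y -> dvdA (genA y) a].

(* Subsets of {a_1, ..., a_n} are encoded by subsets of X. *)
Definition gens (Y : {set X}) : set structA := genA @` [set` Y].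

Definition sumA (d : nat) (Y : {set X}) : structA := \prod_(y in Y) genA y ^+ d.

(* M is identified with {(a, lambda'_a)} through m |-> (cocycle m, lamA m); so
   (a, lambda'_a) is cocycleV a, and lambda'_a is lamA (cocycleV a). *)
Definition mY (d : nat) (Y : {set X}) : structM := cocycleV (sumA d Y).

Definition layerM (i : nat) : set structM := [set m | layerA i (cocycle m)].

(* Meaningful only when #|Y| = #|Z|. *)
Definition MYZ (Y Z : {set X}) : set structM :=
  [set m | [/\ ~ layerA #|Y|.+1 (cocycle m),
               forall y, y \in Y -> dvdA (genA y) (cocycle m) &
               lamA m @` gens Z = gens Y]].

Definition mYMYZ (d : nat) (Y Z : {set X}) : set structM :=
  [set mY d Y * m | m in MYZ Y Z].

Definition cancellative (M : monoidType) (S : set M) : Prop :=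
  forall a b c, S a -> S b -> S c ->
    (c * a = c * b -> a = b) /\ (a * c = b * c -> a = b).

Record admissible (d : nat) : Prop := Admissible {
  admissible_ge2 : (2 <= d)%N;
  admissible_central : forall a b : structA, commute (a ^+ d) b;
  admissible_lamA : forall a b : structA, lamA (cocycleV (a ^+ d)) b = b;
  admissible_cancel : forall Y : {set X}, Y != finset.set0 ->
    ~ layerA #|Y|.+1 (sumA d Y) -> cancellative (mYMYZ d Y Y) }.

Definition cancellative_component (d : nat) (S : set structM) : Prop :=
  exists Y : {set X}, [/\ Y != finset.set0, ~ layerA #|Y|.+1 (sumA d Y) &
                          S = mYMYZ d Y Y].

Definition uniform_index (d i : nat) : {set {set X}} :=
  finset (fun Y : {set X} => (#|Y| == i) && `[< ~ layerA i.+1 (sumA d Y) >]).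

Definition uniform_rel (Y Z : {set X}) : bool :=
  `[< MYZ Y Z !=set0 \/ MYZ Z Y !=set0 >].

Record uniform_component (d : nat) := UniformComponent {
  uniform_level : nat;
  uniform_class : {set {set X}};
  uniform_levelP : (1 <= uniform_level <= #|X|)%N;
  uniform_classP : uniform_class \in
    equivalence_partition uniform_rel (uniform_index d uniform_level) }.

Definition uniform_support (d : nat) (U : uniform_component d) : set structM :=
  [set m | exists Y Z, [/\ Y \in uniform_class U, Z \in uniform_class U &
                           mYMYZ d Y Z m]]
  `|` layerM (uniform_level U).+1.

(* The underlying set of the Rees factor S / I: None is the class of the ideal
   I, and S / I = S when I is empty. *)
Definition rees_factor (S I : set structM) : set (option structM) :=
  [set o | if o is Some m then (S `\` I) m else I !=set0].

Definition rees_mul (I : set structM) (o1 o2 : option structM) :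
    option structM :=
  if (o1, o2) is (Some m1, Some m2) then
    if `[< I (m1 * m2) >] then None else Some (m1 * m2)
  else None.

Definition uniform_carrier (d : nat) (U : uniform_component d) :=
  rees_factor (uniform_support U) (layerM (uniform_level U).+1).

Definition uniform_mul (d : nat) (U : uniform_component d) :=
  rees_mul (layerM (uniform_level U).+1).

Definition degree (d : nat) (U : uniform_component d) : nat :=
  #|uniform_class U|.

End StructureMonoids.

(* Stated for monoids, for which S^1 = S; u k stands for u_(k+1). *)
Fixpoint malcev_pair (S : monoidType) (s t : S) (u : nat -> S) (k : nat) :
    S * S :=
  if k is k'.+1 then
    let: (x, y) := malcev_pair s t u k' in (x * u k' * y, y * u k' * x)
  else (s, t).

Definition malcev_nilpotent (S : monoidType) : Prop :=
  exists k : nat, forall (s t : S) (u : nat -> S),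
    (malcev_pair s t u k).1 = (malcev_pair s t u k).2.

Definition zexpg (G : groupType) (x : G) (k : int) : G :=
  match k with Posz n => x ^+ n | Negz n => x ^- n.+1 end.

Definition abelian_subset (M : monoidType) (S : set M) : Prop :=
  forall a b, S a -> S b -> commute a b.

(* Only the values of f on the subsemigroup S matter. *)
Record is_group_of_fractions (M : monoidType) (S : set M) (G : groupType)
    (f : M -> G) : Prop := IsGroupOfFractions {
  fractions_morph : forall a b, S a -> S b -> f (a * b) = f a * f b;
  fractions_inj : forall a b, S a -> S b -> f a = f b -> a = b;
  fractions_gen : forall g, exists a b, [/\ S a, S b & g = f a * (f b)^-1] }.

Definition zindependent (G : groupType) (n : nat) (e : 'I_n -> G) : Prop :=
  forall k : 'I_n -> int,
    \prod_(i < n) zexpg (e i) (k i) = 1 -> forall i, k i = 0%R.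

Definition abelian_of_rank (G : groupType) (j : nat) : Prop :=
  [/\ forall x y : G, commute x y,
      exists e : 'I_j -> G, zindependent e &
      forall e : 'I_j.+1 -> G, ~ zindependent e].

(* The group of fractions is unique up to isomorphism, so asserting the rank of
   one model G asserts it of all of them. *)
Definition fractions_of_rank (M : monoidType) (S : set M) (j : nat) : Prop :=
  exists (G : groupType) (f : M -> G),
    is_group_of_fractions S f /\ abelian_of_rank G j.

(* c is a cycle with content D; c = 1 when D is a singleton. *)
Definition cycle_on (X : finType) (c : {perm X}) (D : {set X}) : Prop :=
  perm_on D c /\ exists x, D = porbit c x.

Record cycle_powers (X : finType) (sigma tau : {perm X}) (s : nat)
    (c : 'I_s -> {perm X}) (D : 'I_s -> {set X}) (k : 'I_s -> int) : Prop :=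
  CyclePowers {
    cycle_powers_cycle : forall i, cycle_on (c i) (D i);
    cycle_powers_disjoint : forall i j, i != j -> [disjoint D i & D j]%B;
    cycle_powers_cover : forall x, exists i, x \in D i;
    cycle_powers_sigma : sigma = \prod_(i < s) zexpg (c i) (k i);
    cycle_powers_tau : tau = \prod_(i < s) zexpg (c i) (1 - k i)%R }.

(* Main.v *)
(* Put th = sigma tau. In A one has x + z = z + th(x) for all generators x, z.
   Hence sums of two generators are central, and if a sum of at least three
   generators contains two from the same th-orbit, every summand may be moved
   freely within its orbit: such an element is determined by the numbers of its
   summands in each th-orbit. These counts are also invariants of A.

   If sigma preserves the th-orbits, the counts are additive on M, and x_3 and
   y_3 in Malcev's identity have the same counts. Otherwise choose the u_k so
   that the difference D_k of the counts of x_k and y_k, a function on X,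
   satisfies D_{k+1} = (1 - sigma) D_k; as ker (1 - sigma)^2 = ker (1 - sigma),
   starting from the generators x and sigma(x), with sigma(x) outside the
   th-orbit of x, no D_k vanishes. The condition on cycles says precisely that
   sigma preserves the th-orbits, which are then the contents of the c_i.

   A set Y indexes a cancellative component iff it is a non-empty union of
   th-orbits; the counts embed that component into Z^j, where j is the number
   of orbits in Y, and its image generates Z^j. *)
Require Import Defs.
From HB Require Import structures.
From mathcomp Require Import all_boot all_order all_algebra all_fingroup.
From mathcomp Require Import generic_quotient.
From mathcomp Require Import zify boolp classical_sets.

Set Implicit Arguments.
Unset Strict Implicit.
Unset Printing Implicit Defensive.

(** * Powers and products of disjoint cycles *)

Section CyclePowers.
Local Open Scope group_scope.

(** This makes [tau * sigma] act as the cycle [c i] itself on the content of [c i]. *)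
Lemma zexpg_1subr (G : groupType) (x : G) (k : int) :
  zexpg x (1 - k)%R * zexpg x k = x.
Proof.
case: k => [[|n]|n].
- by rewrite (_ : 1 - Posz 0 = Posz 1)%R // mulg1.
- have -> : (1 - Posz n.+1)%R = (- Posz n)%R by lia.
  have -> : zexpg x (- Posz n)%R = x ^- n.
    by case: n => [|n] //=; rewrite invg1.
  by rewrite /= expgSr mulKg.
- have -> : (1 - Negz n)%R = Posz n.+2 by lia.
  by rewrite /= [x ^+ n.+2]expgS mulgK.
Qed.

Variable X : finType.
Implicit Types (c : {perm X}) (D : {set X}).

Lemma perm_on_zexpg c D k : perm_on D c -> perm_on D (zexpg c k).
Proof.
have SE p : perm_on D p = (p \in Sym D) by rewrite inE.
by rewrite !SE; case: k => n /= h; rewrite ?groupV groupX.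
Qed.

Lemma prod_disjoint_perm s (f : 'I_s -> {perm X}) (D : 'I_s -> {set X}) j x :
  (forall i, perm_on (D i) (f i)) ->
  (forall i j, i != j -> [disjoint D i & D j]%B) -> x \in D j ->
  (\prod_(i < s) f i) x = f j x.
Proof.
move=> fD dD xj.
(* Induction over duplicate-free index lists: the factor [f j] then acts at most once, and every
   other factor fixes [D j] pointwise. *)
suff H q : uniq q -> forall y, y \in D j ->
    (\prod_(i <- q) f i) y = if j \in q then f j y else y.
  by rewrite (H _ (index_enum_uniq _)) // mem_index_enum.
elim: q => [_ y _|i q IH /= /andP[iq uq] y yj]; first by rewrite big_nil perm1.
rewrite big_cons permM inE; have [e|ne] := eqVneq j i.
  subst i; by rewrite /= IH ?(perm_closed _ (fD j)) // (negPf iq).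
have yi : y \notin D i by rewrite (disjointFr (dD j i ne) yj).
by rewrite (out_perm (fD i) yi) IH.
Qed.
End CyclePowers.

(** * The cycle condition and invariance of the orbits of [th] *)

Section CyclePowersFacts.
Variables (X : finType) (sigma tau : {perm X}).
Local Open Scope group_scope.
Local Notation th := (tau * sigma).

Section OfCyclePowers.
Variables (s : nat) (c : 'I_s -> {perm X}) (D : 'I_s -> {set X}) (k : 'I_s -> int).
Hypothesis cp : cycle_powers sigma tau c D k.

Let cD i : perm_on (D i) (c i).
Proof. by case: (cycle_powers_cycle cp i). Qed.

Lemma cycle_powers_sigmaE i x : x \in D i -> sigma x = zexpg (c i) (k i) x.
Proof.
move=> xi; rewrite [sigma](cycle_powers_sigma cp).
by apply: prod_disjoint_perm xi => [j|];
  [exact: perm_on_zexpg|exact: cycle_powers_disjoint cp].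
Qed.

Lemma cycle_powers_tauE i x : x \in D i -> tau x = zexpg (c i) (1 - k i)%R x.
Proof.
move=> xi; rewrite [tau](cycle_powers_tau cp).
by apply: prod_disjoint_perm xi => [j|];
  [exact: perm_on_zexpg|exact: cycle_powers_disjoint cp].
Qed.

Lemma cycle_powers_thE i x : x \in D i -> th x = c i x.
Proof.
move=> xi; rewrite permM (cycle_powers_tauE xi) (@cycle_powers_sigmaE i).
  by rewrite -permM zexpg_1subr.
by rewrite (perm_closed _ (perm_on_zexpg _ (cD i))).
Qed.

Lemma cycle_powers_porbit i x : x \in D i -> porbit th x = D i.
Proof.
move=> xi; have [_ [y eD]] := cycle_powers_cycle cp i.
have -> : D i = porbit (c i) x by rewrite eD; apply/esym/eqP; rewrite eq_porbit_mem -eD.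
have h n : (th ^+ n) x = (c i ^+ n) x /\ (c i ^+ n) x \in D i.
  elim: n => [|n [e m]]; first by rewrite !perm1.
  by rewrite !expgSr !(permM (_ ^+ n)) e (cycle_powers_thE m) (perm_closed _ (cD i)).
apply/setP => z; apply/porbitP/porbitP => -[n ->]; exists n; have [] := h n; congruence.
Qed.

Lemma cycle_powers_sigma_orbit x : sigma x \in porbit th x.
Proof.
have [i xi] := cycle_powers_cover cp x.
rewrite (cycle_powers_porbit xi) (cycle_powers_sigmaE xi).
by rewrite (perm_closed _ (perm_on_zexpg _ (cD i))).
Qed.

Lemma cycle_powers_repr i : exists x, x \in D i.
Proof. by have [_ [x ->]] := cycle_powers_cycle cp i; exists x; apply: porbit_id. Qed.
End OfCyclePowers.

(** The cycles are the restrictions of [th] to its orbits. Since [sigma] preserves each orbit and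
    commutes with [th], it agrees there with a power of [th]. *)
Lemma ex_cycle_powers : commute sigma tau ->
  (forall x, sigma x \in porbit th x) ->
  exists (s : nat) (c : 'I_s -> {perm X}) (D : 'I_s -> {set X})
         (k : 'I_s -> int), cycle_powers sigma tau c D k.
Proof.
move=> st hs.
pose D (i : 'I_#|porbits th|) : {set X} := enum_val i.
pose c i := restr_perm (D i) th.
have DE i x : x \in D i -> porbit th x = D i.
  move=> xi; have := enum_valP i; rewrite -/(D i) => /imsetP[y _ eD].
  by rewrite eD; apply/eqP; rewrite eq_porbit_mem -eD.
have D0 i : exists x, x \in D i.
  by have := enum_valP i => /imsetP[y _ eD]; exists y; rewrite /D eD porbit_id.
have thD i x : x \in D i -> th x \in D i.
  by move=> xi; have := mem_porbit th 1 x; rewrite expg1 (DE i x xi).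
have cE i x : x \in D i -> c i x = th x.
  move=> xi; apply: restr_permE => //; rewrite inE /=.
  by apply/andP; split; rewrite inE //;
    apply/fintype.subsetP => y yi; rewrite inE /= /aperm thD.
have cXE i n x : x \in D i -> (c i ^+ n) x = (th ^+ n) x /\ (th ^+ n) x \in D i.
  move=> xi; elim: n => [|n [e m]]; first by rewrite !perm1.
  by rewrite !expgSr !(permM (_ ^+ n)) e cE // thD.
have cth : commute th sigma by apply: commute_sym; apply: commuteM.
have ex i : exists n, forall x, x \in D i -> sigma x = (th ^+ n) x.
  (* The exponent is read off at one point and carried along the orbit by commutation with [th]. *)
  have [x xi] := D0 i; have /porbitP[n en] := hs x; exists n => y.
  rewrite -(DE _ _ xi) => /porbitP[m ->].
  rewrite -permM (commute_sym (commuteX m (commute_sym cth))) permM en.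
  by rewrite -!permM -!expgD addnC.
have [n hn] := boolp.choice ex.
have disj i j : i != j -> [disjoint D i & D j]%B.
  apply: contraNT => /pred0Pn[x /= /andP[xi xj]].
  by apply/eqP/enum_val_inj; rewrite -/(D i) -/(D j) -(DE _ _ xi) -(DE _ _ xj).
have cov x : exists i, x \in D i.
  have p : porbit th x \in porbits th by apply: imset_f.
  by exists (enum_rank_in p (porbit th x)); rewrite /D enum_rankK_in ?porbit_id.
have on i m : perm_on (D i) (zexpg (c i) m) by apply/perm_on_zexpg/restr_perm_on.
exists _, c, D, (fun i => Posz (n i)); split=> //.
- move=> i; split; first exact: restr_perm_on.
  have [x xi] := D0 i; exists x; apply/setP => y; rewrite -(DE _ _ xi).
  apply/porbitP/porbitP => -[m ->]; exists m; have [] := cXE i m x xi; congruence.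
- apply/permP => x; have [i xi] := cov x.
  by rewrite (prod_disjoint_perm _ disj xi) // (hn _ _ xi); case: (cXE i (n i) x xi).
- apply/permP => x; have [i xi] := cov x.
  rewrite (prod_disjoint_perm _ disj xi) //.
  (* [sigma (tau x)] is [th x], so it lies in the orbit of [x]; by [hs] it also lies in that of
     [tau x]. *)
  have txi : tau x \in D i.
    rewrite -(DE _ _ xi) -eq_porbit_mem.
    have := hs (tau x); rewrite -permM -eq_porbit_mem => /eqP <-.
    by have := mem_porbit th 1 x; rewrite expg1 eq_porbit_mem.
  apply: (@perm_inj _ (zexpg (c i) (n i))); rewrite -[RHS]permM zexpg_1subr cE //=.
  by case: (cXE i (n i) _ txi) => -> _; rewrite -hn // -permM.
Qed.
End CyclePowersFacts.

(** * The free abelian group of rank j *)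

Section FreeAbelianGroup.
Import GRing.Theory Num.Theory.
Local Open Scope ring_scope.

(* Z^j in multiplicative notation, as ranks are defined for groupType. *)
Definition zvec (j : nat) : Type := {ffun 'I_j -> int}.

Section Instance.
Variable j : nat.
HB.instance Definition _ := Choice.copy (zvec j) {ffun 'I_j -> int}.

Definition zvec_one : zvec j := [ffun=> 0].
Definition zvec_inv (v : zvec j) : zvec j := [ffun i => - v i].
Definition zvec_mul (v w : zvec j) : zvec j := [ffun i => v i + w i].

Fact zvec_mulA : associative zvec_mul.
Proof. by move=> u v w; apply/ffunP => i; rewrite !ffunE addrA. Qed.
Fact zvec_mul1 : left_id zvec_one zvec_mul.
Proof. by move=> v; apply/ffunP => i; rewrite !ffunE add0r. Qed.
Fact zvec_1mul : right_id zvec_one zvec_mul.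
Proof. by move=> v; apply/ffunP => i; rewrite !ffunE addr0. Qed.
Fact zvec_mulV : left_inverse zvec_one zvec_inv zvec_mul.
Proof. by move=> v; apply/ffunP => i; rewrite !ffunE addNr. Qed.
Fact zvec_Vmul : right_inverse zvec_one zvec_inv zvec_mul.
Proof. by move=> v; apply/ffunP => i; rewrite !ffunE addrN. Qed.

HB.instance Definition _ :=
  isGroup.Build (zvec j) zvec_mulA zvec_mul1 zvec_1mul zvec_mulV zvec_Vmul.
End Instance.

Lemma zvecM j (v w : zvec j) i : (v * w)%g i = v i + w i.
Proof. exact: ffunE. Qed.

Lemma zvecV j (v : zvec j) i : (v^-1)%g i = - v i.
Proof. exact: ffunE. Qed.

Lemma zvec1 j i : (1%g : zvec j) i = 0.
Proof. exact: ffunE. Qed.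

Lemma zvecX j (v : zvec j) n i : (v ^+ n)%g i = n%:Z * v i.
Proof.
elim: n => [|n IH]; first by rewrite mul0r zvec1.
by rewrite expgS zvecM IH intS mulrDl mul1r.
Qed.

Lemma zvec_zexpg j (v : zvec j) k i : zexpg v k i = k * v i.
Proof. by case: k => n; rewrite /= ?zvecV zvecX // NegzE mulNr. Qed.

Lemma zvec_prod j n (e : 'I_n -> zvec j) (k : 'I_n -> int) l :
  (\prod_(i < n) zexpg (e i) (k i))%g l = \sum_(i < n) k i * e i l.
Proof.
elim/big_ind2: _ => [|v x w y <- <-|i _]; first exact: zvec1.
  exact: zvecM.
exact: zvec_zexpg.
Qed.

(** With more rows than columns, the diagonal factor of the Smith normal form [L *m _ *m R] has last
    row zero, so the last row of the inverse of [L] kills [A]. *)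
Lemma int_left_kernel m n (A : 'M[int]_(m, n)) : (n < m)%N ->
  exists2 k : 'rV[int]_m, k != 0 & k *m A = 0.
Proof.
case: m A => // m A nm; have [L uL [R _ [d _ ->]]] := int_Smith_normal_form A.
exists (row ord_max (invmx L)).
  apply/eqP => h; have : row ord_max (invmx L *m L) = 0.
    by rewrite row_mul h mul0mx.
  rewrite mulVmx // => /rowP/(_ ord_max); rewrite !mxE eqxx.
  by move/eqP; rewrite oner_eq0.
rewrite -row_mul !mulmxA mulVmx // mul1mx row_mul.
rewrite (_ : row _ _ = 0) ?mul0mx //; apply/rowP => i; rewrite !mxE.
by case: eqP => [e|_]; rewrite ?mulr0n //; have := ltn_ord i; rewrite -e /= ltnNge -ltnS nm.
Qed.

Lemma zvec_rank j : abelian_of_rank (zvec j) j.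
Proof.
split.
- by move=> x y; apply/ffunP => i; rewrite !zvecM addrC.
- exists (fun i => [ffun l => (l == i)%:Z]) => k /ffunP h i; have := h i.
  rewrite zvec_prod zvec1 (bigD1 i) //= ffunE eqxx mulr1 big1 ?addr0 // => l li.
  by rewrite ffunE eq_sym (negPf li) mulr0.
(* As rows, [j.+1] vectors form a matrix with only [j] columns; a left kernel vector is a forbidden
   relation. *)
- move=> e he.
  have [k k0 kA] := int_left_kernel (\matrix_(i, l) e i l) (ltnSn j).
  case/eqP: k0; apply/rowP => i; rewrite mxE.
  apply: (he (fun i => k ord0 i)); apply/ffunP => l; rewrite zvec_prod zvec1.
  have /rowP/(_ l) := kA; rewrite !mxE => {2}<-.
  by apply: eq_bigr => t _; rewrite mxE.
Qed.
End FreeAbelianGroup.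

(** * The monoid A: length, orbit counts and rewriting of short words *)

Section Lyubashenko.
Variables (X : finType) (sigma tau : {perm X}) (st : commute sigma tau).
Local Open Scope group_scope.

Local Notation r := (lyubashenko st).
Local Notation A := (structA r).
Local Notation g := (genA r).
Local Notation th := (tau * sigma).

Definition wordA (w : seq X) : A := pword (Arel r) w.
Local Notation wd := wordA.

Lemma wordA_cat u v : wd (u ++ v) = wd u * wd v.
Proof. exact: pword_cat. Qed.

Lemma wordA_cons x v : wd (x :: v) = g x * wd v.
Proof. exact: (wordA_cat [:: x]). Qed.

Lemma wordA_repr (a : A) : wd (repr a) = a.
Proof. exact: pwordK. Qed.

(** [len] and [cnt] are read off a chosen representative word; [pcongr_size] and [pcongr_count] show
    that the choice is immaterial. *)
Definition len (a : A) : nat := size (repr a).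
Definition cnt (a : A) (x : X) : nat :=
  count (fun z => z \in porbit th x) (repr a).

Lemma pcongr_size u v : pcongr (Arel r) u v -> size u = size v.
Proof.
elim=> {u v} [_ _ []//|//|//|u v w _ -> _ ->//|u1 v1 u2 v2 _ e1 _ e2].
by rewrite !size_cat e1 e2.
Qed.

Lemma th_expS i y : (th ^+ i.+1) y = th ((th ^+ i) y).
Proof. by rewrite expgSr [LHS]permM. Qed.

Lemma porbit_th x z : (th z \in porbit th x) = (z \in porbit th x).
Proof.
by have := porbit_perm th 1 z; rewrite expg1 -!eq_porbit_mem => ->.
Qed.

Lemma pcongr_count x u v : pcongr (Arel r) u v ->
  count (fun z => z \in porbit th x) u = count (fun z => z \in porbit th x) v.
Proof.
elim=> {u v} [_ _ [y z] /=|//|//|u v w _ -> _ ->//|u1 v1 u2 v2 _ e1 _ e2].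
  by rewrite -permM porbit_th !addn0 addnC.
by rewrite !count_cat e1 e2.
Qed.

Lemma len_word w : len (wd w) = size w.
Proof. exact/pcongr_size/reprP. Qed.

Lemma cnt_word w x : cnt (wd w) x = count (fun z => z \in porbit th x) w.
Proof. exact/pcongr_count/reprP. Qed.

Lemma len_mul a b : len (a * b) = (len a + len b)%N.
Proof.
by rewrite -[a in LHS]wordA_repr -[b in LHS]wordA_repr -wordA_cat len_word size_cat.
Qed.

Lemma cnt_mul a b x : cnt (a * b) x = (cnt a x + cnt b x)%N.
Proof.
by rewrite -[a in LHS]wordA_repr -[b in LHS]wordA_repr -wordA_cat cnt_word count_cat.
Qed.

Lemma cnt_gen y x : cnt (g y) x = (y \in porbit th x).
Proof. by rewrite (cnt_word [:: y]) /= addn0. Qed.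

Lemma cnt1 x : cnt 1 x = 0%N.
Proof. exact: (cnt_word [::]). Qed.

(** Both sides of every relator have length two, so a one-letter word is congruent to itself
    only. *)
Lemma genA_inj : injective g.
Proof.
move=> x y /pwordP.
suff H u v : pcongr (Arel r) u v -> size u = 1%N -> u = v by move/H => /(_ erefl) [].
elim=> {u v} [_ _ []//|//|u v uv IH sv|u v w _ IH1 _ IH2 su|u1 v1 u2 v2 c1 IH1 c2 IH2].
- by rewrite IH // (pcongr_size uv).
- by rewrite IH1 // IH2 // -IH1.
- rewrite size_cat; have [s1 s2] := (pcongr_size c1, pcongr_size c2).
  case E1: (size u1) => [|[|n]] //.
    rewrite add0n => E2; rewrite (IH2 E2) (size0nil E1); move: s1; rewrite E1.
    by move/esym/size0nil->.
  rewrite add1n => -[E2]; rewrite (IH1 E1) (size0nil E2); move: s2; rewrite E2.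
  by move/esym/size0nil->.
Qed.

Lemma genA_swap x z : g x * g z = g z * g (th x).
Proof.
rewrite -!(wordA_cat [:: _]) /=; apply/pwordP/pcongr_rel.
by have := ARel r x (sigma^-1 z); rewrite /= permKV -permM.
Qed.

Lemma genA_th2 x z : g x * g z = g (th x) * g (th z).
Proof. by rewrite genA_swap genA_swap. Qed.

Lemma genA_swapV x z : g z * g x = g (th^-1 x) * g z.
Proof. by rewrite [RHS]genA_swap permKV. Qed.

(** A letter crossing two others to the left applies [th] to both, and [genA_th2] undoes this. *)
Lemma pair_central x z : forall a, commute (g x * g z) a.
Proof.
move=> a; rewrite -[a]wordA_repr; elim: (repr a) => [|y w IH].
  by rewrite /commute (_ : wd [::] = 1) // mul1g mulg1.
rewrite wordA_cons; apply: commuteM => //; rewrite /commute.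
by rewrite -mulgA (genA_swap z y) mulgA (genA_swap x y) -mulgA -genA_th2 mulgA.
Qed.

Lemma genA_th_right x z w : g x * g z * g (th w) = g (th x) * g z * g w.
Proof. by rewrite (genA_th2 x z) -mulgA -genA_th2 mulgA. Qed.

Lemma genA_th_outer x z w : g x * g z * g w = g (th x) * g z * g (th w).
Proof.
by rewrite -[LHS]mulgA (genA_swap z w) mulgA (genA_th2 x w) -mulgA -genA_swap mulgA.
Qed.

(** In a triple, [th] may be applied to both outer letters at once, and may also be shifted from the
    last letter to the first. Together these make its square on one letter invisible. *)
Lemma genA_th_sq x z w : g (th (th x)) * g z * g w = g x * g z * g w.
Proof. by rewrite [RHS]genA_th_outer genA_th_right. Qed.

Lemma genA_th_sq_mid x z w : g x * g (th (th z)) * g w = g x * g z * g w.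
Proof. by rewrite genA_swap genA_th_sq -genA_swap. Qed.

Lemma orbit_pair x y z w : y \in porbit th x -> z \in porbit th x ->
  g y * g z * g w = g x * g x * g w.
Proof.
move=> yx; rewrite -!eq_porbit_mem in yx *; rewrite -(eqP yx) eq_porbit_mem.
move=> /porbitP[i ->].
have -> : g y * g ((th ^+ i) y) * g w = g y * g y * g w.
  (* The third letter allows exponents to be lowered by two; exponent one is the swap of [y] with
     itself. *)
  elim/ltn_ind: i => -[|[|i]] IH; first by rewrite perm1.
    by rewrite expg1 -genA_swap.
  by rewrite !th_expS genA_th_sq_mid IH.
move: yx; rewrite eq_porbit_mem => /porbitP[j ->].
congr (_ * _); elim: j => [|j IH]; first by rewrite perm1.
by rewrite th_expS -genA_th2.
Qed.

Lemma square_th x z : g x * g x * g (th z) = g x * g x * g z.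
Proof.
rewrite genA_th_right; apply: orbit_pair; last exact: porbit_id.
by rewrite porbit_th porbit_id.
Qed.

Lemma square_orbit x y z : y \in porbit th z ->
  g x * g x * g y = g x * g x * g z.
Proof.
move=> /porbitP[i ->]; elim: i => [|i IH]; first by rewrite perm1.
by rewrite th_expS square_th.
Qed.

(** Crossing a letter to the left applies the inverse of [th], so the letter brought to the front
    stays in its orbit. *)
Lemma extract_letter x w : has (fun z => z \in porbit th x) w ->
  exists y w', [/\ y \in porbit th x, size w = (size w').+1,
    wd w = g y * wd w' &
    forall z, count (fun t => t \in porbit th z) w =
              ((y \in porbit th z) + count (fun t => t \in porbit th z) w')%N].
Proof.
elim: w => [//|z w IH] /= /orP[zx|/IH[y [w' [yx -> ew cw]]]].
  by exists z, w; rewrite wordA_cons.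
have ty : th^-1 y \in porbit th x by rewrite -porbit_th permKV.
exists (th^-1 y), (z :: w'); split=> //.
  by rewrite !wordA_cons ew mulgA (genA_swapV y z) mulgA.
by move=> t; rewrite cw /= -[in RHS]porbit_th permKV addnCA.
Qed.

Lemma mem_porbit_eq x y z : y \in porbit th x ->
  (y \in porbit th z) = (x \in porbit th z).
Proof. by rewrite -!eq_porbit_mem => /eqP->. Qed.

Lemma square_word x u v :
  (forall z, count (fun t => t \in porbit th z) u =
             count (fun t => t \in porbit th z) v) ->
  g x * g x * wd u = g x * g x * wd v.
Proof.
elim: u v => [|z u IH] v /= cuv.
  case: v cuv => [//|y v] /(_ y) /=.
  by rewrite porbit_id.
have /extract_letter[y [v' [yz _ -> cv]]] :
    has (fun t => t \in porbit th z) v.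
  by rewrite has_count -cuv porbit_id.
(* The square lets [z] be replaced by [y] and, being central, lets [y] pass to the front, where both
   sides share it. *)
rewrite wordA_cons mulgA -(square_orbit x yz) [RHS]mulgA.
rewrite (pair_central x x (g y)) -!mulgA; congr (_ * _); rewrite !mulgA.
apply: IH => t; have := cuv t; rewrite cv.
by rewrite /= (mem_porbit_eq t yz) => /addnI.
Qed.

(** Length above 2 provides the third letter that [orbit_pair] needs to turn the two extracted
    letters into [x]. *)
Lemma extract_square x (c : A) : (2 < len c)%N -> (1 < cnt c x)%N ->
  exists w, c = g x * g x * wd w /\ forall z, cnt c z =
    ((x \in porbit th z) + ((x \in porbit th z) +
       count (fun t => t \in porbit th z) w))%N.
Proof.
rewrite -[c]wordA_repr len_word; move: (repr c) => u su.
rewrite cnt_word => cu.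
have /extract_letter[y [u1 [yx s1 e1 c1]]] : has (fun z => z \in porbit th x) u.
  by rewrite has_count (leq_trans _ cu).
have /extract_letter[y2 [u2 [yx2 s2 e2 c2]]] : has (fun z => z \in porbit th x) u1.
  by rewrite has_count; move: cu; rewrite c1 yx.
exists u2; split; last by move=> z; rewrite cnt_word c1 c2 !(mem_porbit_eq z yx, mem_porbit_eq z yx2).
move: su; rewrite e1 e2 s1 s2; case: u2 {s2 c2 e2} => [//|z u2 _].
by rewrite wordA_cons !mulgA (orbit_pair _ yx yx2).
Qed.

Lemma eq_of_counts (a b : A) x : (forall z, cnt a z = cnt b z) ->
  (2 < len a)%N -> (2 < len b)%N -> (1 < cnt a x)%N -> a = b.
Proof.
move=> cab la lb ca.
have cb : (1 < cnt b x)%N by rewrite -cab.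
have [[u [ea cu]] [v [eb cv]]] := (extract_square la ca, extract_square lb cb).
by rewrite ea eb; apply: square_word => z; have := cab z; rewrite cu cv => /addnI/addnI.
Qed.

(** * Lengths and counts on M through the cocycle *)

Local Notation M := (structM r).

Lemma actwE w x : actw r w x = (sigma ^+ size w) x.
Proof. by elim: w => [|y w IH] /=; rewrite ?perm1 // IH expgSr permM. Qed.

Lemma cocycle_inj : injective (@cocycle X r).
Proof. exact: can_inj (@cocycleK X r). Qed.

Lemma len_cocycle (m : M) : len (cocycle m) = size (repr m).
Proof.
rewrite /cocycle len_word; elim: (repr m) => [//|x w IH] /=.
by rewrite size_map IH.
Qed.

Lemma len_cocycle_eq0 (m : M) : len (cocycle m) = 0%N -> m = 1.
Proof. by rewrite len_cocycle => /size0nil e; rewrite -[m]pwordK e. Qed.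

Lemma lamA_wordA (m : M) w :
  lamA m (wd w) = wd (map (sigma ^+ len (cocycle m)) w).
Proof.
rewrite -{1}[m]pwordK lamA_word len_cocycle; congr pword.
by apply: eq_map => x; rewrite actwE.
Qed.

Lemma len_lamA (m : M) a : len (lamA m a) = len a.
Proof. by rewrite -[a]wordA_repr lamA_wordA !len_word size_map. Qed.

Lemma porbit_commute (s : {perm X}) z x : commute th s ->
  (s z \in porbit th (s x)) = (z \in porbit th x).
Proof.
(* One implication for every [p] commuting with [th] suffices: the converse is the case of the
   inverse of [s]. *)
suff H (p : {perm X}) y t : commute th p ->
    y \in porbit th t -> p y \in porbit th (p t).
  move=> c; apply/idP/idP; last exact: H.
  by move/(H s^-1 _ _ (commuteV c)); rewrite !permK.
move=> c /porbitP[i ->].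
by rewrite -permM (commute_sym (commuteX i (commute_sym c))) permM mem_porbit.
Qed.

Lemma commute_th_sigma i : commute th (sigma ^+ i).
Proof.
by apply: commuteX; apply: commute_sym; apply: commuteM.
Qed.

Lemma cnt_lamA (m : M) a x :
  cnt (lamA m a) ((sigma ^+ len (cocycle m)) x) = cnt a x.
Proof.
rewrite -[a]wordA_repr lamA_wordA !cnt_word count_map; apply: eq_count => z /=.
exact/porbit_commute/commute_th_sigma.
Qed.

Lemma len_cocycleM (m1 m2 : M) :
  len (cocycle (m1 * m2)) = (len (cocycle m1) + len (cocycle m2))%N.
Proof. by rewrite cocycleM len_mul len_lamA. Qed.

Lemma cnt_cocycleM (m1 m2 : M) x : cnt (cocycle (m1 * m2)) x =
  (cnt (cocycle m1) x + cnt (cocycle m2) ((sigma ^- len (cocycle m1)) x))%N.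
Proof.
rewrite cocycleM cnt_mul -[in LHS](permKV (sigma ^+ len (cocycle m1)) x).
by rewrite cnt_lamA permKV.
Qed.

Lemma cnt_eq_orbit a x y : y \in porbit th x -> cnt a y = cnt a x.
Proof. by rewrite -eq_porbit_mem /cnt => /eqP->. Qed.

Lemma cnt_letter w z : z \in w -> (0 < cnt (wd w) z)%N.
Proof.
by move=> zw; rewrite cnt_word -has_count; apply/hasP; exists z; rewrite ?porbit_id.
Qed.

(** * Malcev nilpotency when sigma preserves the orbits *)

Section SigmaPreservesOrbits.
Hypothesis sigma_th : forall x, sigma x \in porbit th x.

Lemma sigmaX_orbit i x : (sigma ^+ i) x \in porbit th x.
Proof.
elim: i => [|i]; first by rewrite perm1 porbit_id.
rewrite expgSr permM -!eq_porbit_mem => /eqP <-.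
by rewrite eq_porbit_mem sigma_th.
Qed.

Lemma cnt_cocycle_add (m1 m2 : M) x : cnt (cocycle (m1 * m2)) x =
  (cnt (cocycle m1) x + cnt (cocycle m2) x)%N.
Proof.
rewrite cnt_cocycleM; congr addn; apply: cnt_eq_orbit.
by rewrite porbit_sym -{1}[x](permKV (sigma ^+ len (cocycle m1))) sigmaX_orbit.
Qed.

Lemma cocycle_eq_of_counts (m1 m2 : M) x :
  (forall z, cnt (cocycle m1) z = cnt (cocycle m2) z) ->
  (2 < len (cocycle m1))%N -> (2 < len (cocycle m2))%N ->
  (1 < cnt (cocycle m1) x)%N -> m1 = m2.
Proof. by move=> h l1 l2 c; apply: cocycle_inj; apply: eq_of_counts h l1 l2 c. Qed.

Lemma malcev_nilpotent_lyubashenko : malcev_nilpotent M.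
Proof.
(* After three steps both sides contain [s] and [t] four times each, so unless both are 1 the length
   exceeds 2 and some count exceeds 1. *)
exists 3%N => s t u /=.
have [/eqP|lp] := posnP (len (cocycle s) + len (cocycle t)).
  rewrite addn_eq0 => /andP[/eqP/len_cocycle_eq0-> /eqP/len_cocycle_eq0->] //.
have [x cx] : exists x, (0 < cnt (cocycle s) x + cnt (cocycle t) x)%N.
  have ex (a : A) : (0 < len a)%N -> exists x, (0 < cnt a x)%N.
    case E: (repr a) => [|x w]; rewrite /len E // => _; exists x.
    by rewrite -[a]wordA_repr E cnt_letter ?mem_head.
  by move: lp; rewrite addn_gt0 => /orP[] /ex[x hx]; exists x; rewrite addn_gt0 hx ?orbT.
apply: (@cocycle_eq_of_counts _ _ x) => [z|||];
  rewrite ?cnt_cocycle_add ?len_cocycleM; lia.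
Qed.
End SigmaPreservesOrbits.

(** * The difference operator and the converse implication *)

Section Delta.
Import GRing.Theory Num.Theory.
Local Open Scope ring_scope.

Definition delta (s : {perm X}) (v : X -> int) (x : X) : int := v x - v (s^-1%g x).

Lemma deltaE s v x : delta s v x = v x - v (s^-1%g x).
Proof. by []. Qed.

(** If w = [delta s v] is invariant under s, then v decreases by w(x) at each step of the inverse of
    s from x. Returning to x after the order of that inverse forces w(x) = 0. *)
Lemma delta_delta_eq0 s v :
  (forall x, delta s (delta s v) x = 0) -> forall x, delta s v x = 0.
Proof.
move=> h x; have wE i : delta s v ((s^-1 ^+ i)%g x) = delta s v x.
  elim: i => [|i <-]; first by rewrite perm1.
  by rewrite expgSr permM; apply/esym/eqP; rewrite -subr_eq0; apply/eqP/h.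
have vE i : v ((s^-1 ^+ i)%g x) = v x - delta s v x *+ i.
  elim: i => [|i IH]; first by rewrite perm1 subr0.
  rewrite mulrS opprD addrCA -IH -(wE i) expgSr permM /delta.
  by rewrite opprB subrK.
have := vE #[s^-1]%g; rewrite expg_order perm1 => /eqP.
rewrite eq_sym -subr_eq0 addrAC subrr add0r oppr_eq0 mulrn_eq0.
by case/orP => [|/eqP//]; rewrite eqn0Ngt order_gt0.
Qed.

Lemma iter_delta_eq0 s v k :
  (forall x, iter k.+1 (delta s) v x = 0) -> forall x, delta s v x = 0.
Proof. by elim: k => [//|k IH] h; apply: IH => x; apply: delta_delta_eq0. Qed.
End Delta.

Lemma sigma_orbit_of_malcev : malcev_nilpotent M ->
  forall x, sigma x \in porbit th x.
Proof.
case=> k hk x; set N := #[sigma].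
(* The length of [u i] is -i modulo [N], while x_i has length i + 1 modulo [N]; hence the product of
   x_i and [u i] acts as [sigma]. *)
pose u i : M := cocycleV (wd (nseq (i * N.-1) x)).
(* [e] is the count function of the generator [x]; the initial difference of counts is
   [delta sigma e]. *)
pose e y : int := (x \in porbit th y).
pose p i := malcev_pair (genM r x) (genM r (sigma x)) u i.
have cu i : cocycle (u i) = wd (nseq (i * N.-1) x) by rewrite cocycleVK.
have H i : [/\ len (cocycle (p i).1) = len (cocycle (p i).2),
    sigma ^+ len (cocycle (p i).1) = sigma ^+ i.+1 &
    forall y, ((cnt (cocycle (p i).1) y)%:Z - (cnt (cocycle (p i).2) y)%:Z)%R =
       iter i.+1 (delta sigma) e y].
  elim: i => [|i]; first split=> [||y].
  - by rewrite /p /= !cocycle_gen !(len_word [:: _]).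
  - by rewrite /p /= !cocycle_gen !(len_word [:: _]).
  - rewrite /p /= !cocycle_gen !cnt_gen /delta /e.
    by have := porbit_commute x (sigma^-1 y) (commute_th_sigma 1); rewrite expg1 permKV => ->.
  rewrite /p /=; case: (malcev_pair _ _ u i) => a b /= [le se de].
  have es : sigma ^+ (len (cocycle a) + i * N.-1) = sigma.
    rewrite expgD se -expgD.
    have -> : (i.+1 + i * N.-1 = i * N + 1)%N 
      by have := order_gt0 sigma; rewrite -/N; case: (N) => // n _;
        rewrite mulnS addn1 addSn.
    by rewrite expgD mulnC expgM expg_order expg1n mul1g.
  split=> [||y].
  - by rewrite !len_cocycleM le addnAC.
  - by rewrite !len_cocycleM expgD cu len_word size_nseq es -le se -expgS.
  - rewrite [RHS]deltaE /= -!de !cnt_cocycleM !len_cocycleM -le.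
    rewrite cu len_word size_nseq es; lia.
have {}hk y : iter k.+1 (delta sigma) e y = 0%R.
  by have [_ _ <-] := H k; rewrite /p hk GRing.subrr.
(* At [sigma x] this compares [e (sigma x)] with [e x], which is 1. *)
have /GRing.subr0_eq := iter_delta_eq0 hk (sigma x).
rewrite permK /e porbit_id porbit_sym; by case: (_ \in _).
Qed.

(** * Cancellative and uniform components *)

Section Components.
Implicit Types Y Z : {set X}.
Hypothesis sigma_th : forall x, sigma x \in porbit th x.

Lemma cnt_le_len (a : A) x : (cnt a x <= len a)%N.
Proof. exact: count_size. Qed.

Lemma cnt_prod (I : Type) (q : seq I) (P : pred I) (F : I -> A) x :
  cnt (\prod_(i <- q | P i) F i) x = (\sum_(i <- q | P i) cnt (F i) x)%N.
Proof. by apply: (big_morph (cnt^~ x)) => [a b|]; rewrite ?cnt_mul ?cnt1. Qed.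

Lemma cnt_expg (a : A) n x : cnt (a ^+ n) x = (n * cnt a x)%N.
Proof. by elim: n => [|n IH]; rewrite ?cnt1 // expgS cnt_mul IH mulSn. Qed.

Lemma cnt_dvdA y (a : A) : dvdA (g y) a -> (0 < cnt a y)%N.
Proof. by case=> c ->; rewrite cnt_mul cnt_gen porbit_id. Qed.

Lemma ex_dvdA x (a : A) : (0 < cnt a x)%N ->
  exists2 y, y \in porbit th x & dvdA (g y) a.
Proof.
rewrite -has_count => /extract_letter[y [w [yx _ e _]]].
by exists y => //; exists (wd w); rewrite -e wordA_repr.
Qed.

Lemma square_eq y z : z \in porbit th y -> g y * g y = g z * g z.
Proof.
move=> /porbitP[i ->]; elim: i => [|i ->]; first by rewrite perm1.
by rewrite th_expS -genA_th2.
Qed.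

(** Unions of [th]-orbits; by [layer_sumA] they are the sets that index components. *)
Definition orbit_closed (Y : {set X}) :=
  forall y z, y \in Y -> z \in porbit th y -> z \in Y.

Definition supported (Y : {set X}) (a : A) :=
  forall x, (0 < cnt a x)%N -> x \in Y.

Lemma supported_layer Y a : supported Y a -> ~ layerA #|Y|.+1 a.
Proof.
move=> sY [Z lZ dZ]; have /subset_leq_card : Z \subset Y.
  by apply/fintype.subsetP => z /dZ/cnt_dvdA/sY.
by rewrite leqNgt lZ.
Qed.

(** A letter counted outside [Y] yields a divisor in its orbit, which closure keeps outside [Y]:
    that would be one divisor too many. *)
Lemma layer_supported Y a : orbit_closed Y -> ~ layerA #|Y|.+1 a ->
  (forall y, y \in Y -> dvdA (g y) a) -> supported Y a.
Proof.
move=> cY la dY x /ex_dvdA[y yx ya].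
case: (boolP (x \in Y)) => // xY; case: la; exists (y |: Y).
  rewrite cardsU1 (contra _ xY) // => yY.
  by apply: (cY y) => //; rewrite porbit_sym.
by move=> z /setU1P[->//|/dY].
Qed.

Lemma lamA_genA (m : M) y : lamA m (g y) = g ((sigma ^+ len (cocycle m)) y).
Proof. exact: (lamA_wordA m [:: y]). Qed.

Lemma lamA_gens m Y : orbit_closed Y ->
  image (@gens X r Y) (lamA m) = @gens X r Y.
Proof.
move=> cY; apply/seteqP; split=> [_ [_ [y yY <-] <-]|_ [y yY <-]].
  rewrite lamA_genA; exists ((sigma ^+ len (cocycle m)) y) => //=.
  exact: cY yY (sigmaX_orbit sigma_th _ _).
exists (g ((sigma ^- len (cocycle m)) y)); last by rewrite lamA_genA permKV.
exists ((sigma ^- len (cocycle m)) y) => //=; apply: cY yY _.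
by rewrite porbit_sym -{1}[y](permKV (sigma ^+ len (cocycle m))) sigmaX_orbit.
Qed.

Lemma gens_inj : injective (@gens X r).
Proof.
move=> Y Z e; apply/setP => x; apply/idP/idP => xY.
  have : @gens X r Z (g x) by rewrite -e; exists x.
  by case=> z zZ /genA_inj <-.
have : @gens X r Y (g x) by rewrite e; exists x.
by case=> z zZ /genA_inj <-.
Qed.

(** Each lambda' acts on generators as a power of [sigma], hence stabilises unions of orbits. This
    is what makes the uniform components have degree 1. *)
Lemma MYZ_closed_eq (m : M) Y Z : orbit_closed Z -> MYZ Y Z m -> Y = Z.
Proof. by move=> cZ [_ _]; rewrite (lamA_gens m cZ) => /gens_inj. Qed.

Lemma MYY_supported Y (m : M) : orbit_closed Y ->
  MYZ Y Y m <-> supported Y (cocycle m) /\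
                forall y, y \in Y -> dvdA (g y) (cocycle m).
Proof.
move=> cY; split=> [[l dY _]|[sY dY]]; first by split=> //; apply: layer_supported.
by split=> //; [exact: supported_layer|exact: lamA_gens].
Qed.

Variable d : nat.
Hypothesis adm : admissible r d.

Let d2 : (2 <= d)%N := admissible_ge2 adm.

Lemma sumA_factor Y y : y \in Y -> exists c, sumA r d Y = g y ^+ d * c.
Proof.
move=> yY; have : y \in index_enum X by rewrite mem_index_enum.
rewrite /sumA; elim: (index_enum X) => [//|x q IH].
rewrite big_cons inE; have [<-|ne] /= := eqVneq y x.
  by move=> _; rewrite yY; eexists.
move=> /IH[c ->]; case: ifP => _; last by exists c.
exists (g x ^+ d * c).
by rewrite !mulgA (admissible_central adm (g x) (g y ^+ d)).
Qed.

(** As d is at least 2, [g y ^+ d] contains the square of [g y], which equals that of [g z]. *)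
Lemma dvdA_sumA Y y z : y \in Y -> z \in porbit th y -> dvdA (g z) (sumA r d Y).
Proof.
move=> /sumA_factor[c ->] zy; case: d d2 => [|[|n]] // _.
exists (g z * g y ^+ n * c).
by rewrite 2!expgS !mulgA (square_eq zy).
Qed.

Lemma cnt_sumA Y x :
  cnt (sumA r d Y) x = (\sum_(y in Y) d * (y \in porbit th x))%N.
Proof. by rewrite cnt_prod; apply: eq_bigr => y _; rewrite cnt_expg cnt_gen. Qed.

Lemma cnt_sumA_ge Y y : y \in Y -> (d <= cnt (sumA r d Y) y)%N.
Proof.
by move=> yY; rewrite cnt_sumA (bigD1 y) //= porbit_id muln1 leq_addr.
Qed.

Lemma sumA_supported Y : orbit_closed Y -> supported Y (sumA r d Y).
Proof.
move=> cY x; rewrite cnt_sumA => h.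
have /existsP[y /andP[yY yx]] : [exists y, (y \in Y) && (y \in porbit th x)].
  apply: contraLR h => /existsPn h; rewrite -eqn0Ngt; apply/eqP/big1 => y yY.
  by have := h y; rewrite yY /= => /negPf ->; rewrite muln0.
by apply: cY yY _; rewrite porbit_sym.
Qed.

Lemma layer_sumA Y : ~ layerA #|Y|.+1 (sumA r d Y) <-> orbit_closed Y.
Proof.
split=> [l y z yY zy|cY]; last exact/supported_layer/sumA_supported.
case: (boolP (z \in Y)) => // zY; case: l; exists (z |: Y).
  by rewrite cardsU1 zY.
move=> t /setU1P[->|tY]; first exact: dvdA_sumA yY zy.
by apply: dvdA_sumA tY _; apply: porbit_id.
Qed.

Lemma component_supported Y m : orbit_closed Y -> mYMYZ d Y Y m ->
  supported Y (cocycle m) /\ forall y, y \in Y -> (2 < cnt (cocycle m) y)%N.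
Proof.
move=> cY [m' /(MYY_supported _ cY)[sY dY] <-].
split=> [x|y yY]; rewrite cnt_cocycle_add // cocycleVK.
  by rewrite addn_gt0 => /orP[/sumA_supported|/sY] //; apply.
(* The factor [mY] contributes at least d, hence 2, and the factor from [MYZ Y Y] at least 1. *)
have := cnt_sumA_ge yY; have := cnt_dvdA (dY y yY); move: d2; lia.
Qed.

Lemma component_eq Y m1 m2 : orbit_closed Y -> Y != finset.set0 ->
  mYMYZ d Y Y m1 -> mYMYZ d Y Y m2 ->
  (forall y, y \in Y -> cnt (cocycle m1) y = cnt (cocycle m2) y) -> m1 = m2.
Proof.
move=> cY /set0Pn[y yY] /(component_supported cY)[s1 c1].
move=> /(component_supported cY)[s2 c2] e.
apply: (@cocycle_eq_of_counts _ _ y) => [x|||].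
- case: (boolP (x \in Y)) => [/e//|xY].
  have c0 m : supported Y (cocycle m) -> cnt (cocycle m) x = 0%N.
    by move=> sm; apply/eqP; rewrite eqn0Ngt; apply: contra xY; apply: sm.
  by rewrite !c0.
- exact: leq_trans (c1 y yY) (cnt_le_len _ _).
- exact: leq_trans (c2 y yY) (cnt_le_len _ _).
- exact: ltnW (c1 y yY).
Qed.

Lemma component_abelian Y : orbit_closed Y -> Y != finset.set0 ->
  abelian_subset (mYMYZ d Y Y : set M).
Proof.
move=> cY /set0Pn[y yY] a b /(component_supported cY)[_ /(_ y yY) ca].
move=> /(component_supported cY)[_ /(_ y yY) cb].
have := (cnt_le_len (cocycle a) y, cnt_le_len (cocycle b) y) => -[la lb].
apply: (@cocycle_eq_of_counts _ _ y) => // [x|||];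
  rewrite ?len_cocycleM ?cnt_cocycle_add //; lia.
Qed.

Lemma uniform_degree (U : uniform_component r d) : degree U = 1%N.
Proof.
case: U => i C iP CP; rewrite /degree /=.
case/imsetP: CP => Y YI ->.
have idx Z : Z \in uniform_index r d i -> orbit_closed Z.
  by rewrite inE => /andP[/eqP <- /asboolP/layer_sumA].
rewrite (_ : finset _ = [set Y]%SET) ?cards1 //.
apply/setP => Z; rewrite inE [in RHS]inE; apply/andP/eqP => [[ZI]|->].
  by move=> /asboolP[] [m] mYZ; [apply/esym|]; apply: MYZ_closed_eq mYZ; apply: idx.
split=> //; apply/asboolP; left; exists (cocycleV (sumA r d Y)).
apply/MYY_supported; first exact: idx.
rewrite cocycleVK; split; first exact/sumA_supported/idx.
by move=> y yY; apply: dvdA_sumA yY (porbit_id _ _).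
Qed.

(** * Groups of fractions and their ranks *)

Section Fractions.
Variables (s : nat) (c : 'I_s -> {perm X}) (D : 'I_s -> {set X}) (k : 'I_s -> int).
Hypothesis cp : cycle_powers sigma tau c D k.

Definition cycles_in (Y : {set X}) : {set 'I_s} :=
  finset (fun i => D i \subset Y).

(** Counts at one representative of each cycle inside [Y] embed the component into Z^j; it remains
    to see that differences of such count vectors fill Z^j. *)
Lemma component_fractions Y : orbit_closed Y -> Y != finset.set0 ->
  fractions_of_rank (mYMYZ d Y Y : set M) #|cycles_in Y|.
Proof.
move=> cY Y0; set j := #|_|.
have [p pD] := boolp.choice (cycle_powers_repr cp).
pose e (i : 'I_j) : X := p (enum_val i).
have eD i : e i \in D (enum_val i) by apply: pD.
have eY i : e i \in Y.
  have := enum_valP i; rewrite inE => /fintype.subsetP; apply; exact: eD.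
have ee i l : (e i \in porbit th (e l)) = (i == l).
  rewrite (cycle_powers_porbit cp (eD l)); apply/idP/eqP => [il|->//].
  apply/enum_val_inj/eqP; apply: contraT => /(cycle_powers_disjoint cp)/disjointFr.
  by move/(_ _ (eD i)); rewrite il.
pose f (m : M) : zvec j := [ffun i => Posz (cnt (cocycle m) (e i))].
exists (zvec j), f; split; last exact: zvec_rank.
split=> [a b _ _|a b Sa Sb /ffunP fab|v].
- by apply/ffunP => i; rewrite zvecM !ffunE cnt_cocycle_add.
- apply: (component_eq cY Y0 Sa Sb) => y yY.
  have [i yi] := cycle_powers_cover cp y.
  have iY : i \in cycles_in Y.
    rewrite inE -(cycle_powers_porbit cp yi); apply/fintype.subsetP => z.
    exact: cY.
  have := fab (enum_rank_in iY i); rewrite !ffunE => -[].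
  have -> : e (enum_rank_in iY i) = p i by rewrite /e enum_rankK_in.
  have py : p i \in porbit th y by rewrite (cycle_powers_porbit cp yi).
  by rewrite !(cnt_eq_orbit _ py).
(* The summand a_Y makes [q n] divisible by all of [Y], hence a member of [MYZ Y Y]; its counts
   cancel in quotients. *)
pose q (n : 'I_j -> nat) : M :=
  cocycleV (sumA r d Y * \prod_i g (e i) ^+ n i).
have qS n : mYMYZ d Y Y (mY r d Y * q n).
  exists (q n) => //; apply/MYY_supported => //; rewrite cocycleVK; split=> [x|y yY].
    rewrite cnt_mul addn_gt0 => /orP[/sumA_supported|]; first exact.
    rewrite cnt_prod; apply: contraTT => xY; rewrite -eqn0Ngt big1 // => i _.
    rewrite cnt_expg cnt_gen; case: (boolP (_ \in _)) => [ix|_]; last exact: muln0.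
    by case/negP: xY; apply: (cY (e i)) => //; rewrite porbit_sym.
  have [a ->] := dvdA_sumA yY (porbit_id _ _).
  by exists (a * \prod_i g (e i) ^+ n i); rewrite mulgA.
have cq n i : cnt (\prod_l g (e l) ^+ n l : A) (e i) = n i.
  rewrite cnt_prod (bigD1 i) //= cnt_expg cnt_gen porbit_id muln1 big1 ?addn0 //.
  by move=> l li; rewrite cnt_expg cnt_gen ee (negPf li) muln0.
have fq n i : f (mY r d Y * q n) i =
    Posz (cnt (sumA r d Y) (e i) + cnt (sumA r d Y) (e i) + n i)%N.
  by rewrite ffunE cnt_cocycle_add // !cocycleVK cnt_mul cq addnA.
(* Numerator and denominator carry the positive and negative parts of [v]; [Negz n] stands for -(n +
   1). *)
exists (mY r d Y * q (fun i => if v i is Posz n then n else 0%N)).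
exists (mY r d Y * q (fun i => if v i is Negz n then n.+1 else 0%N)).
split=> //; apply/ffunP => i; rewrite zvecM zvecV !fq.
by case: (v i) => n; lia.
Qed.

Lemma card_cycles_in_bound Y : orbit_closed Y -> Y != finset.set0 ->
  (1 <= #|cycles_in Y| <= s)%N.
Proof.
move=> cY /set0Pn[y yY]; have := max_card (cycles_in Y).
rewrite card_ord => ->; rewrite andbT card_gt0.
have [i yi] := cycle_powers_cover cp y; apply/set0Pn; exists i.
rewrite inE -(cycle_powers_porbit cp yi); apply/fintype.subsetP => z.
exact: cY.
Qed.

Lemma ex_card_cycles_in j : (1 <= j <= s)%N ->
  exists Y, [/\ orbit_closed Y, Y != finset.set0 & #|cycles_in Y| = j].
Proof.
case/andP=> j1 js; pose w := widen_ord js.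
(* The union of the contents of the first [j] cycles. *)
pose Y : {set X} := finset (fun x => [exists i, x \in D (w i)]).
have DY i x l : x \in D i -> x \in D l -> i = l.
  move=> xi xl; apply/eqP; apply: contraT => /(cycle_powers_disjoint cp)/disjointFr.
  by move/(_ _ xi); rewrite xl.
exists Y; split.
- move=> y z; rewrite !inE => /existsP[i yi] zy; apply/existsP; exists i.
  by rewrite -(cycle_powers_porbit cp yi).
- have [x x0] := cycle_powers_repr cp (w (Ordinal j1)).
  by apply/set0Pn; exists x; rewrite inE; apply/existsP; exists (Ordinal j1).
- have w_inj : injective w by move=> a b /(congr1 val) ab; apply: val_inj.
  rewrite -[RHS]card_ord -(card_imset predT w_inj).
  apply: eq_card => i; rewrite inE; apply/fintype.subsetP/imsetP.
    move=> iY; have [x xi] := cycle_powers_repr cp i.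
    have := iY _ xi; rewrite inE => /existsP[l xl]; exists l => //.
    exact: DY xi xl.
  move=> [l _ ->] x xl; rewrite inE; apply/existsP; by exists l.
Qed.
End Fractions.
End Components.
End Lyubashenko.

Theorem proposition3p10 (X : finType) (hX : (0 < #|X|)%N)
    (sigma tau : {perm X}) (st : commute sigma tau) :
  let r := lyubashenko st in
  (malcev_nilpotent (structM r) <->
   exists (s : nat) (c : 'I_s -> {perm X}) (D : 'I_s -> {set X})
          (k : 'I_s -> int), cycle_powers sigma tau c D k) /\
  (forall (s : nat) (c : 'I_s -> {perm X}) (D : 'I_s -> {set X})
          (k : 'I_s -> int), cycle_powers sigma tau c D k ->
   forall d : nat, admissible r d ->
   [/\ forall S : set (structM r), cancellative_component d S ->
         abelian_subset S /\
         exists j : nat, (1 <= j <= s)%N /\ fractions_of_rank S j,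
       forall j : nat, (1 <= j <= s)%N ->
         exists S : set (structM r),
           cancellative_component d S /\ fractions_of_rank S j &
       forall U : uniform_component r d, degree U = 1%N]).
Proof.
split.
  split=> [/sigma_orbit_of_malcev|[s [c [D [k cp]]]]]; first exact: ex_cycle_powers.
  exact/malcev_nilpotent_lyubashenko/(cycle_powers_sigma_orbit cp).
move=> s c D k cp d adm; have hs := cycle_powers_sigma_orbit cp.
split=> [S [Y [Y0 /(layer_sumA adm) cY ->]]|j js|U].
- split; first exact: component_abelian.
  exists #|cycles_in D Y|; split; last exact: component_fractions cp _ cY Y0.
  exact: card_cycles_in_bound cp _ cY Y0.
- have [Y [cY Y0 <-]] := ex_card_cycles_in cp js.
  exists (mYMYZ d Y Y); split; last exact: component_fractions cp _ cY Y0.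
  by exists Y; split=> //; apply/(layer_sumA adm).
- exact: uniform_degree.
Qed.
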